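(* The functor $\mathbf{M}$ (taking concentration monoids) preserves sub-, quotient-, and semidirect product structures from categories with concentration to monoids; that is: (i) (Sub) If $(\mathcal{B},\sim|_{\mathcal{B}})$ is a sub-concentration of a category with concentration $(\mathcal{C},\sim)$, then $M_{(\mathcal{B},\sim|_{\mathcal{B}})}$ is a submonoid of $M_{(\mathcal{C},\sim)}$. (ii) (Quotient) If $(\mathcal{B},\sim|_{\mathcal{B}})$ is a normal sub-concentration of $(\mathcal{C},\sim)$, with quotient concentration $\sim_{/\mathcal{B}}$ on $\mathcal{C}$, then $$M_{(\mathcal{C},\sim_{/\mathcal{B}})}\cong M_{(\mathcal{C},\sim)}/M_{(\mathcal{B},\sim|_{\mathcal{B}})}.$$ (iii) (Semidirect product) Let $(\mathcal{C},\sim_{\mathcal{C}})$ and $(\mathcal{D},\sim_{\mathcal{D}})$ be categories with concentration, let $\Phi:\mathcal{D}\to\mathcal{A}ut(\mathcal{C})$ be a functor compatible with the two concentrations, and let $\phi:M_{(\mathcal{D},\sim_{\mathcal{D}})}\to\mathrm{Aut}(M_{(\mathcal{C},\sim_{\mathcal{C}})})$ be the well-defined homomorphism induced by $\Phi$, $(\phi[f])[\alpha]=[\Phi_f(\alpha)]$. Then $$M_{(\mathcal{C}\rtimes_{\Phi}\mathcal{D},\sim_{\rtimes_{\Phi}})}\cong M_{(\mathcal{C},\sim_{\mathcal{C}})}\rtimes_{\phi}M_{(\mathcal{D},\sim_{\mathcal{D}})}.$$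
   Context: All categories carrying a concentration structure are small. For a category $\mathcal{C}$, $\mathrm{Mor}_{\mathcal{C}}$ is the set of all its morphisms; $f\circ g$ means first $g$, then $f$. A concentration structure on $\mathcal{C}$ is an equivalence relation $\sim$ on $\mathrm{Mor}_{\mathcal{C}}$ such that: (1) $\mathrm{id}_A\sim \mathrm{id}_B$ for any objects $A,B$; (2) if $f\sim f'$, $g\sim g'$ and both $f\circ g$, $f'\circ g'$ exist, then $f\circ g\sim f'\circ g'$; (3) for any morphisms $f,g$ there exist some $f'\sim f$ and $g'\sim g$ such that $f'\circ g'$ exists; (4) for any morphisms $f\sim f'$, $g\sim g'$, $h\sim h'$, $m\sim f\circ g$, $n\sim g'\circ h'$, one has $f'\circ n\sim m\circ h$ whenever all the compositions are well defined. The pair $(\mathcal{C},\sim)$ is called a category with concentration. Its concentration monoid is $M_{(\mathcal{C},\sim)}=\mathrm{Mor}_{\mathcal{C}}/\sim$ with multiplication $[f][g]=[f'\circ g']$, where $f'\sim f$, $g'\sim g$ and $f'\circ g'$ exists; its identity is the class of the identity morphism of an arbitrary object. The functor $\mathbf{M}$ sends $(\mathcal{C},\sim)$ to $M_{(\mathcal{C},\sim)}$. Sub-concentration: for a subcategory $\mathcal{B}$ of $\mathcal{C}$, if the restriction $\sim|_{\mathcal{B}}$ of $\sim$ to $\mathrm{Mor}_{\mathcal{B}}$ is a concentration structure on $\mathcal{B}$, then $(\mathcal{B},\sim|_{\mathcal{B}})$ is called a sub-concentration of $(\mathcal{C},\sim)$. It is normal if for any $f\in\mathrm{Mor}_{\mathcal{C}}$,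 $h\in\mathrm{Mor}_{\mathcal{B}}$ there exist $h_1,h_2\in\mathrm{Mor}_{\mathcal{B}}$ with $[f][h]=[h_1][f]$ and $[h][f]=[f][h_2]$. Quotient concentration: for a normal sub-concentration, $\sim_{/\mathcal{B}}$ is the concentration structure on $\mathcal{C}$ defined by $f\sim_{/\mathcal{B}}g$ iff there exist $h_1,h_2\in\mathrm{Mor}_{\mathcal{B}}$ with $[h_1][f]=[g][h_2]$. Quotient monoid: a submonoid $S$ of a monoid $M$ is normal if $xS=Sx$ for each $x\in M$ (for a normal sub-concentration, $M_{(\mathcal{B},\sim|_{\mathcal{B}})}$ is a normal submonoid of $M_{(\mathcal{C},\sim)}$). A normal $S$ induces the congruence $a\,\mathcal{R}_S\,b$ iff there exist $s_1,s_2\in S$ with $s_1a=bs_2$; $M/S$ denotes the quotient monoid $M/\mathcal{R}_S$. Semidirect product of categories: $\mathcal{A}ut(\mathcal{C})$ is the category with a single object whose morphisms are the strongly invertible functors $\mathcal{C}\to\mathcal{C}$ (those having a strict inverse functor), with composition of functors. For a functor $\Phi:\mathcal{D}\to\mathcal{A}ut(\mathcal{C})$ write $\Phi_f=\Phi(f)$. It is compatible with the two concentrations if $\alpha\sim_{\mathcal{C}}\alpha'$ and $f\sim_{\mathcal{D}}f'$ imply $\Phi_f(\alpha)\sim_{\mathcal{C}}\Phi_{f'}(\alpha')$. The category $\mathcal{C}\rtimes_{\Phi}\mathcal{D}$ has object set $\mathrm{Ob}(\mathcal{C})\times\mathrm{Ob}(\mathcal{D})$; morphisms $(C_1,D_1)\to(C_2,D_2)$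 are pairs $(\alpha,f)$ with $f\in\mathrm{Mor}(D_1,D_2)$ and $\alpha\in\mathrm{Mor}(\Phi_f(C_1),C_2)$; composition is $(\alpha_2,f_2)\circ(\alpha_1,f_1)=(\alpha_2\circ\Phi_{f_2}(\alpha_1),f_2\circ f_1)$. The concentration structure $\sim_{\rtimes_\Phi}$ on it is: $(\alpha,f)\sim_{\rtimes_\Phi}(\alpha',f')$ iff $\alpha\sim_{\mathcal{C}}\alpha'$ and $f\sim_{\mathcal{D}}f'$. Semidirect product of monoids: for monoids $M,N$ and a homomorphism $\phi:N\to\mathrm{Aut}(M)$, $n\mapsto\phi_n$, $M\rtimes_\phi N$ is the set $M\times N$ with multiplication $(m_1,n_1)(m_2,n_2)=(m_1\phi_{n_1}(m_2),n_1n_2)$.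
   Formalization: In (iii), the existence of the induced homomorphism φ into Aut(M_C) is assumed: compatibility of Φ alone does not make each φ[f] injective (e.g. a shift on a free commutative monoid). Categories with concentration are taken to be nonempty. *)

(* Defs.v *)
From HB Require Import structures.
From mathcomp Require Import all_boot.
From mathcomp Require Import all_classical.

Set Implicit Arguments.
Unset Strict Implicit.
Unset Printing Implicit Defensive.

Local Open Scope classical_set_scope.
Local Open Scope group_scope.
Local Open Scope quotient_scope.

(* Presented by objects and arrows, so that equality of objects, of arrows and
   of functors is plain equality.  [cmp f g] is f after g, and takes a proof
   that f and g are composable. *)
Record category := Category {
  ob : Type;
  mor : Type;
  source : mor -> ob;
  target : mor -> ob;
  idm : ob -> mor;
  cmp : forall f g : mor, source f = target g -> mor;
  source_id : forall A, source (idm A) = A;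
  target_id : forall A, target (idm A) = A;
  source_cmp : forall f g (e : source f = target g), source (cmp e) = source g;
  target_cmp : forall f g (e : source f = target g), target (cmp e) = target f;
  cmp_idl : forall f (e : source (idm (target f)) = target f), cmp e = f;
  cmp_idr : forall f (e : source f = target (idm (source f))), cmp e = f;
  cmpA : forall f g h (fg : source f = target g) (gh : source g = target h)
    (f_gh : source f = target (cmp gh)) (fg_h : source (cmp fg) = target h),
    cmp f_gh = cmp fg_h
}.

Arguments idm {c} A.
Arguments cmp {c} f g e.

Lemma cmp_congr (C : category) (f f' g g' : mor C)
    (e : source f = target g) (e' : source f' = target g') :
  f = f' -> g = g' -> cmp f g e = cmp f' g' e'.
Proof. by move=> ff gg; subst; congr cmp; exact: Prop_irrelevance. Qed.

Record functor (C D : category) := Functor {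
  fob : ob C -> ob D;
  fmor : mor C -> mor D;
  fsource : forall f, source (fmor f) = fob (source f);
  ftarget : forall f, target (fmor f) = fob (target f);
  fid : forall A, fmor (idm A) = idm (fob A);
  fcmp : forall f g (e : source f = target g)
    (e' : source (fmor f) = target (fmor g)),
    fmor (cmp f g e) = cmp (fmor f) (fmor g) e'
}.

Lemma functor_ext (C D : category) (F G : functor C D) :
  fob F =1 fob G -> fmor F =1 fmor G -> F = G.
Proof.
case: F => [F0 F1 a b c d]; case: G => [G0 G1 a' b' c' d'] /= /funext E0 /funext E1.
by subst; congr Functor; exact: Prop_irrelevance.
Qed.

Definition functor_id (C : category) : functor C C.
Proof.
by refine (@Functor C C id id _ _ _ _) => // f g e e'; apply: cmp_congr.
Defined.

Definition functor_comp (C D E : category) (G : functor D E) (F : functor C D) :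
  functor C E.
Proof.
refine (@Functor C E (fob G \o fob F) (fmor G \o fmor F) _ _ _ _) => /=.
- by move=> f; rewrite !fsource.
- by move=> f; rewrite !ftarget.
- by move=> A; rewrite !fid.
- move=> f g e e'; have e1 : source (fmor F f) = target (fmor F g) by rewrite fsource ftarget e.
  by rewrite (fcmp e e1) (fcmp e1 e').
Defined.

Definition strongly_invertible (C D : category) (F : functor C D) : Prop :=
  exists G : functor D C,
    functor_comp G F = functor_id C /\ functor_comp F G = functor_id D.

Record autofunctor (C : category) := AutoFunctor {
  autofunctor_fun :> functor C C;
  autofunctor_inv : strongly_invertible autofunctor_fun
}.

Lemma autofunctor_ext (C : category) (F G : autofunctor C) :
  fob F =1 fob G -> fmor F =1 fmor G -> F = G.
Proof.
case: F => F iF; case: G => G iG /= E0 E1.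
have FG : F = G by exact: functor_ext.
by subst; congr AutoFunctor; exact: Prop_irrelevance.
Qed.

Definition autofunctor_id (C : category) : autofunctor C.
Proof.
by refine (@AutoFunctor C (functor_id C) _); exists (functor_id C); split;
  apply: functor_ext.
Defined.

Definition autofunctor_comp (C : category) (F G : autofunctor C) : autofunctor C.
Proof.
refine (@AutoFunctor C (functor_comp F G) _).
have [F' [F'F FF']] := autofunctor_inv F.
have [G' [G'G GG']] := autofunctor_inv G.
have ob1 H K x : functor_comp H K = functor_id C -> fob H (fob K x) = x.
  by move=> HK; have := congr1 (fun f => fob f x) HK.
have mor1 H K x : functor_comp H K = functor_id C -> fmor H (fmor K x) = x.
  by move=> HK; have := congr1 (fun f => fmor f x) HK.
exists (functor_comp G' F'); split; apply: functor_ext => x /=.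
- by rewrite (ob1 _ _ _ _ F'F) (ob1 _ _ _ _ G'G).
- by rewrite (mor1 _ _ _ _ F'F) (mor1 _ _ _ _ G'G).
- by rewrite (ob1 _ _ _ _ GG') (ob1 _ _ _ _ FF').
- by rewrite (mor1 _ _ _ _ GG') (mor1 _ _ _ _ FF').
Defined.

Definition aut_category (C : category) : category.
Proof.
refine (@Category unit (autofunctor C) (fun=> tt) (fun=> tt)
  (fun=> autofunctor_id C) (fun F G _ => autofunctor_comp F G)
  _ _ _ _ _ _ _) => //; try by case.
- by move=> F _; apply: autofunctor_ext.
- by move=> F _; apply: autofunctor_ext.
- by move=> F G H _ _ _ _; apply: autofunctor_ext.
Defined.

Record subcategory (C : category) := Subcategory {
  sub_ob : set (ob C);
  sub_mor : set (mor C);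
  sub_source : forall f, sub_mor f -> sub_ob (source f);
  sub_target : forall f, sub_mor f -> sub_ob (target f);
  sub_id : forall A, sub_ob A -> sub_mor (idm A);
  sub_cmp : forall f g (e : source f = target g),
    sub_mor f -> sub_mor g -> sub_mor (cmp f g e)
}.

Definition category_of_sub (C : category) (B : subcategory C) : category.
Proof.
pose elt T (S : set T) (x : T) (Sx : S x) : set_type S := SigSub (mem_set Sx).
refine (@Category (sub_ob B) (sub_mor B)
  (fun f => elt _ _ (source (val f)) (sub_source (set_valP f)))
  (fun f => elt _ _ (target (val f)) (sub_target (set_valP f)))
  (fun A => elt _ _ (idm (val A)) (sub_id (set_valP A)))
  (fun f g e => elt _ _ (cmp (val f) (val g) (congr1 val e))
                  (sub_cmp (congr1 val e) (set_valP f) (set_valP g)))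
  _ _ _ _ _ _ _).
- by move=> A; apply: val_inj; rewrite /= source_id.
- by move=> A; apply: val_inj; rewrite /= target_id.
- by move=> f g e; apply: val_inj; rewrite /= source_cmp.
- by move=> f g e; apply: val_inj; rewrite /= target_cmp.
- by move=> f e; apply: val_inj; rewrite /= cmp_idl.
- by move=> f e; apply: val_inj; rewrite /= cmp_idr.
- by move=> f g h fg gh f_gh fg_h; apply: val_inj; apply: cmpA.
Defined.

(* The first clause excludes the empty category, for which Mor/~ is empty and
   hence not a monoid: the unit of the concentration monoid is the class of the
   identity of some object. *)
Record is_concentration (C : category) (R : mor C -> mor C -> Prop) : Prop :=
    IsConcentration {
  conc_inh : inhabited (ob C);
  conc_refl : forall f, R f f;
  conc_sym : forall f g, R f g -> R g f;
  conc_trans : forall f g h, R f g -> R g h -> R f h;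
  conc_id : forall A B, R (idm A) (idm B);
  conc_cmp : forall f f' g g' (e : source f = target g)
    (e' : source f' = target g'),
    R f f' -> R g g' -> R (cmp f g e) (cmp f' g' e');
  conc_ex : forall f g, exists f' g',
    [/\ R f' f, R g' g & source f' = target g'];
  conc_assoc : forall f f' g g' h h' m n
    (fg : source f = target g) (gh : source g' = target h')
    (fn : source f' = target n) (mh : source m = target h),
    R f f' -> R g g' -> R h h' -> R m (cmp f g fg) -> R n (cmp g' h' gh) ->
    R (cmp f' n fn) (cmp m h mh)
}.

Record conc_category := ConcCategory {
  conc_cat :> category;
  conc_rel : mor conc_cat -> mor conc_cat -> Prop;
  conc_relP : is_concentration conc_rel
}.

Definition conc_relb (X : conc_category) : rel {classic (mor X)} :=
  fun f g => `[< conc_rel f g >].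

Lemma conc_relb_refl X : reflexive (@conc_relb X).
Proof. by move=> f; apply/asboolP; exact: (conc_refl (conc_relP X)). Qed.

Lemma conc_relb_sym X : symmetric (@conc_relb X).
Proof.
by move=> f g; apply: asbool_equiv_eq; split; apply: (conc_sym (conc_relP X)).
Qed.

Lemma conc_relb_trans X : transitive (@conc_relb X).
Proof.
move=> g f h /asboolP fg /asboolP gh.
by apply/asboolP; exact: (conc_trans (conc_relP X)) fg gh.
Qed.

Canonical conc_equiv (X : conc_category) :=
  EquivRel (@conc_relb X) (@conc_relb_refl X) (@conc_relb_sym X)
    (@conc_relb_trans X).

Definition conc_monoid (X : conc_category) : Type := {eq_quot (@conc_relb X)}.

HB.instance Definition _ (X : conc_category) := Choice.on (conc_monoid X).

Definition cls (X : conc_category) (f : mor X) : conc_monoid X :=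
  \pi_{eq_quot (@conc_relb X)} (f : {classic (mor X)}).

Section ConcMonoid.
Variable X : conc_category.
Implicit Types (f g : mor X) (x y z : conc_monoid X).

Lemma cls_eqP f g : cls f = cls g <-> conc_rel f g.
Proof. by rewrite /cls; split=> [/eqmodP/asboolP//|fg]; apply/eqmodP/asboolP. Qed.

Lemma clsP x : exists f, x = cls f.
Proof. by exists (repr x); rewrite /cls reprK. Qed.

Lemma conc_one_ex : exists x, exists A : ob X, x = cls (idm A).
Proof. by have [A] := conc_inh (conc_relP X); exists (cls (idm A)), A. Qed.

Definition conc_one : conc_monoid X := projT1 (cid conc_one_ex).

Lemma conc_mul_ex x y : exists z, exists f g (e : source f = target g),
  [/\ x = cls f, y = cls g & z = cls (cmp f g e)].
Proof.
have [[f ->] [g ->]] := (clsP x, clsP y).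
have [f' [g' [ff gg e]]] := conc_ex (conc_relP X) f g.
exists (cls (cmp f' g' e)), f', g', e; split=> //;
  by apply/cls_eqP/(conc_sym (conc_relP X)).
Qed.

Definition conc_mul x y : conc_monoid X := projT1 (cid (conc_mul_ex x y)).

Lemma conc_oneE A : conc_one = cls (idm A).
Proof.
rewrite /conc_one; case: cid => x /= [B ->].
by apply/cls_eqP; exact: (conc_id (conc_relP X)).
Qed.

Lemma conc_mulE f g (e : source f = target g) :
  conc_mul (cls f) (cls g) = cls (cmp f g e).
Proof.
rewrite /conc_mul; case: cid => z /= [f' [g' [e' [/cls_eqP ff /cls_eqP gg ->]]]].
apply/cls_eqP; apply: (conc_cmp (conc_relP X));
  by apply: (conc_sym (conc_relP X)).
Qed.

Lemma conc_mulA : associative conc_mul.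
Proof.
move=> x y z.
rewrite {2}/conc_mul; case: cid => yz /= [g' [h' [gh [yE zE ->]]]].
rewrite {3}/conc_mul; case: cid => xy /= [f [g [fg [xE yE' ->]]]].
rewrite {1}/conc_mul; case: cid => x_yz /= [f' [n [fn [xE' nE ->]]]].
rewrite {1}/conc_mul; case: cid => xy_z /= [m [h [mh [mE zE' ->]]]].
apply/cls_eqP; apply: (conc_assoc (conc_relP X) (fg := fg) (gh := gh));
  apply/cls_eqP; congruence.
Qed.

Lemma conc_mul1 : left_id conc_one conc_mul.
Proof.
move=> x; have [f ->] := clsP x.
have e : source (idm (target f)) = target f by rewrite source_id.
by rewrite (conc_oneE (target f)) (conc_mulE e) cmp_idl.
Qed.

Lemma conc_mulr1 : right_id conc_one conc_mul.
Proof.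
move=> x; have [f ->] := clsP x.
have e : source f = target (idm (source f)) by rewrite target_id.
by rewrite (conc_oneE (source f)) (conc_mulE e) cmp_idr.
Qed.

HB.instance Definition _ :=
  isMonoid.Build (conc_monoid X) conc_mulA conc_mul1 conc_mulr1.

Lemma cls_id A : 1 = cls (idm A). Proof. exact: conc_oneE. Qed.

Lemma cls_cmp f g (e : source f = target g) : cls (cmp f g e) = cls f * cls g.
Proof. by rewrite -(conc_mulE e). Qed.

Lemma cls_ex x y : exists f g, [/\ x = cls f, y = cls g & source f = target g].
Proof. by have [z [f [g [e [-> -> _]]]]] := conc_mul_ex x y; exists f, g. Qed.

End ConcMonoid.

(* A relation on Mor which is the pull-back along [cls] of a monoid congruence
   is again a concentration structure. *)
Lemma congruence_concentration (X : conc_category)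
    (R : conc_monoid X -> conc_monoid X -> Prop) :
  (forall x, R x x) -> (forall x y, R x y -> R y x) ->
  (forall x y z, R x y -> R y z -> R x z) ->
  (forall x x' y y', R x x' -> R y y' -> R (x * y) (x' * y')) ->
  is_concentration (fun f g : mor X => R (cls f) (cls g)).
Proof.
move=> Rr Rs Rt Rm; split.
- exact: conc_inh (conc_relP X).
- by move=> f; exact: Rr.
- by move=> f g; exact: Rs.
- by move=> f g h; exact: Rt.
- by move=> A B; rewrite -!cls_id; exact: Rr.
- by move=> f f' g g' e e' ff gg; rewrite !cls_cmp; exact: Rm.
- move=> f g; have [f' [g' [ff gg e]]] := cls_ex (cls f) (cls g).
  by exists f', g'; split=> //; rewrite (ff, gg).
- move=> f f' g g' h h' m n fg gh fn mh; rewrite !cls_cmp => ff gg hh mE nE.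
  apply: (Rt _ (cls f' * (cls g' * cls h'))); first exact: Rm.
  apply: (Rt _ ((cls f * cls g) * cls h)).
    by rewrite mulgA; apply: (Rm); [apply: (Rm)|]; apply: (Rs).
  by apply: Rm => //; exact: Rs.
Qed.

Definition monoid_iso (M N : monoidType) : Prop :=
  exists f : M -> N, monoid_morphism f /\ bijective f.

Definition submonoid (M : monoidType) (S : set M) : Prop :=
  S 1 /\ forall x y, S x -> S y -> S (x * y).

Record normal_submonoid (M : monoidType) := NormalSubmonoid {
  nsm_set : set M;
  nsm_sub : submonoid nsm_set;
  nsm_normal : forall x : M,
    [set x * s | s in nsm_set] = [set s * x | s in nsm_set]
}.

Section QuotientMonoid.
Variables (M : monoidType) (S : normal_submonoid M).
Implicit Types a b : M.

Definition nsm_rel a b : Prop :=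
  exists s1 s2, [/\ nsm_set S s1, nsm_set S s2 & s1 * a = b * s2].

Lemma nsm_swapl s a : nsm_set S s -> exists2 t, nsm_set S t & s * a = a * t.
Proof.
move=> Ss; have : [set u * a | u in nsm_set S] (s * a) by exists s.
by rewrite -nsm_normal => -[t St <-]; exists t.
Qed.

Lemma nsm_swapr s a : nsm_set S s -> exists2 t, nsm_set S t & a * s = t * a.
Proof.
move=> Ss; have : [set a * u | u in nsm_set S] (a * s) by exists s.
by rewrite nsm_normal => -[t St <-]; exists t.
Qed.

Lemma nsm_rel_refl a : nsm_rel a a.
Proof.
have [S1 _] := nsm_sub S; exists 1, 1; split=> //.
by rewrite mul1g mulg1.
Qed.

Lemma nsm_rel_sym a b : nsm_rel a b -> nsm_rel b a.
Proof.
move=> [s1 [s2 [S1 S2 E]]].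
have [t1 T1 E1] := nsm_swapl a S1; have [t2 T2 E2] := nsm_swapr b S2.
by exists t2, t1; split=> //; rewrite -E2 -E.
Qed.

Lemma nsm_rel_trans a b c : nsm_rel a b -> nsm_rel b c -> nsm_rel a c.
Proof.
have [_ SM] := nsm_sub S.
move=> [s1 [s2 [S1 S2 E]]] [t1 [t2 [T1 T2 E']]].
exists (t1 * s1), (t2 * s2); split; [exact: SM|exact: SM|].
by rewrite -mulgA E !mulgA E'.
Qed.

Lemma nsm_rel_mul a a' b b' :
  nsm_rel a a' -> nsm_rel b b' -> nsm_rel (a * b) (a' * b').
Proof.
have [_ SM] := nsm_sub S.
move=> [s [t [Ss St E]]] [s' [t' [Ss' St' E']]].
have [u Su Eu] := nsm_swapr a Ss'; have [v Sv Ev] := nsm_swapl b' St.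
exists (s * u), (v * t'); split; [exact: SM|exact: SM|].
by rewrite -mulgA [u * _]mulgA -Eu -[a * s' * b]mulgA E' 3!mulgA E
   -[a' * t * b']mulgA Ev !mulgA.
Qed.

Definition nsm_relb : rel M := fun a b => `[< nsm_rel a b >].

Lemma nsm_relb_refl : reflexive nsm_relb.
Proof. by move=> a; apply/asboolP; exact: nsm_rel_refl. Qed.

Lemma nsm_relb_sym : symmetric nsm_relb.
Proof. by move=> a b; apply: asbool_equiv_eq; split; exact: nsm_rel_sym. Qed.

Lemma nsm_relb_trans : transitive nsm_relb.
Proof.
by move=> b a c /asboolP ab /asboolP bc; apply/asboolP; exact: nsm_rel_trans bc.
Qed.

Canonical nsm_equiv :=
  EquivRel nsm_relb nsm_relb_refl nsm_relb_sym nsm_relb_trans.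

Definition quotient_monoid : Type := {eq_quot nsm_relb}.

HB.instance Definition _ := Choice.on quotient_monoid.

Definition nsm_pi a : quotient_monoid := \pi_{eq_quot nsm_relb} a.

Lemma nsm_piP a b : nsm_pi a = nsm_pi b <-> nsm_rel a b.
Proof. by rewrite /nsm_pi; split=> [/eqmodP/asboolP//|ab]; apply/eqmodP/asboolP. Qed.

Lemma nsm_pi_surj x : exists a, x = nsm_pi a.
Proof. by exists (repr x); rewrite /nsm_pi reprK. Qed.

Definition quotient_one : quotient_monoid := nsm_pi 1.

Definition quotient_mul (x y : quotient_monoid) : quotient_monoid :=
  nsm_pi (repr x * repr y).

Lemma quotient_mulE a b : quotient_mul (nsm_pi a) (nsm_pi b) = nsm_pi (a * b).
Proof.
by apply/nsm_piP; apply: nsm_rel_mul; apply/nsm_piP; rewrite /nsm_pi reprK.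
Qed.

Lemma quotient_mulA : associative quotient_mul.
Proof.
move=> x y z; have [[a ->] [b ->] [c ->]] :=
  And3 (nsm_pi_surj x) (nsm_pi_surj y) (nsm_pi_surj z).
by rewrite !quotient_mulE mulgA.
Qed.

Lemma quotient_mul1 : left_id quotient_one quotient_mul.
Proof. by move=> x; have [a ->] := nsm_pi_surj x; rewrite quotient_mulE mul1g. Qed.

Lemma quotient_mulr1 : right_id quotient_one quotient_mul.
Proof. by move=> x; have [a ->] := nsm_pi_surj x; rewrite quotient_mulE mulg1. Qed.

HB.instance Definition _ :=
  isMonoid.Build quotient_monoid quotient_mulA quotient_mul1 quotient_mulr1.

End QuotientMonoid.

Record monoid_aut (M : monoidType) := MonoidAut {
  maut_fun :> M -> M;
  maut_morph : monoid_morphism maut_fun;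
  maut_bij : bijective maut_fun
}.

Section MonoidAut.
Variable M : monoidType.

Lemma maut_ext (u v : monoid_aut M) : u =1 v -> u = v.
Proof.
case: u => u mu bu; case: v => v mv bv /= /funext uv.
by subst; congr MonoidAut; exact: Prop_irrelevance.
Qed.

Definition maut_one : monoid_aut M.
Proof. by refine (@MonoidAut M id _ _); [split|exists id]. Defined.

Definition maut_mul (u v : monoid_aut M) : monoid_aut M.
Proof.
refine (@MonoidAut M (u \o v) _ _).
- have [u1 uM] := maut_morph u; have [v1 vM] := maut_morph v.
  by split=> [|x y] /=; rewrite ?v1 ?u1 ?vM ?uM.
- exact: bij_comp (maut_bij u) (maut_bij v).
Defined.

Lemma maut_mulA : associative maut_mul.
Proof. by move=> u v w; apply: maut_ext. Qed.

Lemma maut_mul1 : left_id maut_one maut_mul.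
Proof. by move=> u; apply: maut_ext. Qed.

Lemma maut_mulr1 : right_id maut_one maut_mul.
Proof. by move=> u; apply: maut_ext. Qed.

HB.instance Definition _ := gen_eqMixin (monoid_aut M).
HB.instance Definition _ := gen_choiceMixin (monoid_aut M).
HB.instance Definition _ :=
  isMonoid.Build (monoid_aut M) maut_mulA maut_mul1 maut_mulr1.

End MonoidAut.

(* Homomorphisms N -> Aut(M) are the library's bundled monoid morphisms. *)
Notation monoid_action M N := (UMagmaMorphism.type N (monoid_aut M)).

Definition sdprod_monoid (M N : monoidType) (phi : monoid_action M N) : Type :=
  (M * N)%type.

Section SemidirectMonoid.
Variables (M N : monoidType) (phi : monoid_action M N).

HB.instance Definition _ := gen_eqMixin (sdprod_monoid phi).
HB.instance Definition _ := gen_choiceMixin (sdprod_monoid phi).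

Definition sdprod_one : sdprod_monoid phi := (1, 1).

Definition sdprod_mul (x y : sdprod_monoid phi) : sdprod_monoid phi :=
  (x.1 * phi x.2 y.1, x.2 * y.2).

Lemma sdprod_mulA : associative sdprod_mul.
Proof.
move=> [a b] [c d] [e f]; rewrite /sdprod_mul /=.
by rewrite gmulfM (maut_morph (phi b)).2 /= !mulgA.
Qed.

Lemma sdprod_mul1 : left_id sdprod_one sdprod_mul.
Proof. by move=> [a b]; rewrite /sdprod_mul /= gmulf1 /= !mul1g. Qed.

Lemma sdprod_mulr1 : right_id sdprod_one sdprod_mul.
Proof. by move=> [a b]; rewrite /sdprod_mul /= (maut_morph (phi b)).1 !mulg1. Qed.

HB.instance Definition _ :=
  isMonoid.Build (sdprod_monoid phi) sdprod_mulA sdprod_mul1 sdprod_mulr1.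

End SemidirectMonoid.

Record sub_concentration (X : conc_category) := SubConcentration {
  subc_sub :> subcategory X;
  subc_conc : is_concentration
    (fun f g : mor (category_of_sub subc_sub) => conc_rel (val f) (val g))
}.

Definition conc_category_of_sub (X : conc_category) (B : sub_concentration X) :
  conc_category := ConcCategory (subc_conc B).

(* The canonical map from M_B to M_X, through which M_B is regarded as a subset
   of M_X; it does not depend on the chosen representative (see [subc_inclE]). *)
Definition subc_incl (X : conc_category) (B : sub_concentration X)
    (x : conc_monoid (conc_category_of_sub B)) : conc_monoid X :=
  let f : mor (conc_category_of_sub B) :=
    repr (x : {eq_quot (@conc_relb (conc_category_of_sub B))}) in
  cls (val f).

Definition normal_sub_concentration (X : conc_category)
    (B : sub_concentration X) : Prop :=
  forall f h : mor X, sub_mor B h -> exists h1 h2 : mor X,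
    [/\ sub_mor B h1, sub_mor B h2,
        cls f * cls h = cls h1 * cls f & cls h * cls f = cls f * cls h2].

Definition quotient_rel (X : conc_category) (B : sub_concentration X)
    (f g : mor X) : Prop :=
  exists h1 h2 : mor X,
    [/\ sub_mor B h1, sub_mor B h2 & cls h1 * cls f = cls g * cls h2].

Section SubConcentration.
Variables (X : conc_category) (B : sub_concentration X).
Let Y := conc_category_of_sub B.

Lemma subc_inclE (f : mor Y) : subc_incl (cls f) = cls (val f).
Proof.
by apply/cls_eqP; rewrite -[conc_rel _ _]/(@conc_rel Y _ f); apply/cls_eqP;
  rewrite {1}/cls reprK.
Qed.

Lemma subc_incl_rangeP (x : conc_monoid X) :
  range (@subc_incl X B) x <-> exists2 h, sub_mor B h & x = cls h.
Proof.
split=> [[y _ <-]|[h Bh ->]].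
  by have [f ->] := clsP y; rewrite subc_inclE; exists (val f) => //; exact: set_valP.
by exists (cls (SigSub (mem_set Bh) : mor Y)); rewrite ?subc_inclE.
Qed.

Lemma subc_range_submonoid : submonoid (range (@subc_incl X B)).
Proof.
split.
  have [A] := conc_inh (subc_conc B); apply/subc_incl_rangeP.
  exists (idm (val A)); first by apply: sub_id; exact: set_valP.
  exact: cls_id.
move=> _ _ [x _ <-] [y _ <-]; have [f [g [-> -> e]]] := cls_ex x y.
apply/subc_incl_rangeP; rewrite !subc_inclE.
have e' : source (val f) = target (val g) by exact: (congr1 val e).
exists (cmp (val f) (val g) e'); last by rewrite cls_cmp.
by apply: sub_cmp; exact: set_valP.
Qed.

Hypothesis nB : normal_sub_concentration B.

Lemma subc_range_normal (x : conc_monoid X) :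
  [set x * s | s in range (@subc_incl X B)] =
  [set s * x | s in range (@subc_incl X B)].
Proof.
have [f ->] := clsP x; apply/seteqP; split=> _ [_ /subc_incl_rangeP[h Bh ->] <-];
  have [h1 [h2 [B1 B2 E1 E2]]] := nB f Bh.
- by exists (cls h1) => //; apply/subc_incl_rangeP; exists h1.
- by exists (cls h2) => //; apply/subc_incl_rangeP; exists h2.
Qed.

Definition subc_normal_submonoid : normal_submonoid (conc_monoid X) :=
  NormalSubmonoid subc_range_submonoid subc_range_normal.

Lemma quotient_relE f g :
  quotient_rel B f g <-> nsm_rel subc_normal_submonoid (cls f) (cls g).
Proof.
split=> [[h1 [h2 [B1 B2 E]]]|[_ [_ [/subc_incl_rangeP[h1 B1 ->]
  /subc_incl_rangeP[h2 B2 ->] E]]]]; last by exists h1, h2.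
by exists (cls h1), (cls h2); split=> //; apply/subc_incl_rangeP; [exists h1|exists h2].
Qed.

Lemma quotient_rel_concentration : is_concentration (quotient_rel B).
Proof.
have -> : quotient_rel B =
    (fun f g => nsm_rel subc_normal_submonoid (cls f) (cls g)).
  by apply/funext => f; apply/funext => g; apply/propext; exact: quotient_relE.
by apply: congruence_concentration; [exact: nsm_rel_refl|exact: nsm_rel_sym|
  exact: nsm_rel_trans|exact: nsm_rel_mul].
Qed.

Definition quotient_conc_category : conc_category :=
  ConcCategory quotient_rel_concentration.

End SubConcentration.

Definition act (C D : category) (Phi : functor D (aut_category C))
    (f : mor D) : functor C C :=
  autofunctor_fun (fmor Phi f : autofunctor C).

Section SemidirectCategory.
Variables (C D : category) (Phi : functor D (aut_category C)).

(* The arrow (alpha, f) with source (C1, source f); recording C1 makes alpha an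
   arrow Phi_f(C1) -> target alpha. *)
Record sdprod_mor := SdprodMor {
  sd_ob : ob C;
  sd_fst : mor C;
  sd_snd : mor D;
  sd_source : source sd_fst = fob (act Phi sd_snd) sd_ob
}.

Lemma sdprod_mor_ext (x y : sdprod_mor) :
  sd_ob x = sd_ob y -> sd_fst x = sd_fst y -> sd_snd x = sd_snd y -> x = y.
Proof.
case: x => a b c e; case: y => a' b' c' e' /= ? ? ?.
by subst; congr SdprodMor; exact: Prop_irrelevance.
Qed.

Lemma act_idE A : act Phi (idm A) = functor_id C.
Proof. by rewrite /act fid. Qed.

Lemma act_cmpE f g (e : source f = target g) :
  act Phi (cmp f g e) = functor_comp (act Phi f) (act Phi g).
Proof.
have e' : source (fmor Phi f) = target (fmor Phi g) by rewrite fsource ftarget e.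
by rewrite /act (fcmp e e').
Qed.

Definition sdprod_id (A : ob C * ob D) : sdprod_mor.
Proof.
refine (@SdprodMor A.1 (idm A.1) (idm A.2) _).
by rewrite act_idE source_id.
Defined.

Lemma sdprod_cmp_fst (x y : sdprod_mor) (e : sd_ob x = target (sd_fst y)) :
  source (sd_fst x) = target (fmor (act Phi (sd_snd x)) (sd_fst y)).
Proof. by rewrite sd_source ftarget e. Qed.

Definition sdprod_cmp (x y : sdprod_mor)
    (e : (sd_ob x, source (sd_snd x)) =
         (target (sd_fst y), target (sd_snd y))) : sdprod_mor.
Proof.
refine (@SdprodMor (sd_ob y)
  (cmp (sd_fst x) (fmor (act Phi (sd_snd x)) (sd_fst y))
       (sdprod_cmp_fst (congr1 fst e)))
  (cmp (sd_snd x) (sd_snd y) (congr1 snd e)) _).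
by rewrite source_cmp fsource sd_source act_cmpE.
Defined.

Definition sdprod_category : category.
Proof.
refine (@Category (ob C * ob D)%type sdprod_mor
  (fun x => (sd_ob x, source (sd_snd x)))
  (fun x => (target (sd_fst x), target (sd_snd x)))
  sdprod_id sdprod_cmp _ _ _ _ _ _ _).
- by move=> [A B] /=; rewrite source_id.
- by move=> [A B] /=; rewrite !target_id.
- by move=> x y e /=; rewrite source_cmp.
- by move=> x y e /=; rewrite !target_cmp.
- move=> x e; apply: sdprod_mor_ext => //=.
  + rewrite -[RHS]cmp_idl ?source_id // => e1; apply: cmp_congr => //.
    by rewrite act_idE.
  + exact: cmp_idl.
- move=> x e; apply: sdprod_mor_ext => //=.
  + rewrite -[RHS]cmp_idr ?target_id // => e1; apply: cmp_congr => //.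
    by rewrite fid sd_source.
  + exact: cmp_idr.
- move=> x y z xy yz x_yz xy_z; apply: sdprod_mor_ext => //=; last exact: cmpA.
  have [/= e1 e2] : sd_ob x = target (sd_fst y) /\ source (sd_snd x) = target (sd_snd y).
    by case: (xy).
  have [/= e3 e4] : sd_ob y = target (sd_fst z) /\ source (sd_snd y) = target (sd_snd z).
    by case: (yz).
  have e5 : source (fmor (act Phi (sd_snd x)) (sd_fst y)) =
      target (fmor (act Phi (sd_snd x)) (fmor (act Phi (sd_snd y)) (sd_fst z))).
    by rewrite fsource !ftarget sd_source e3.
  have e6 : source (sd_fst x) = target (cmp _ _ e5).
    by rewrite target_cmp sd_source ftarget e1.
  have e7 : source (sd_fst x) = target (fmor (act Phi (sd_snd x)) (sd_fst y)).
    by rewrite sd_source ftarget e1.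
  have e8 : source (cmp _ _ e7) =
      target (fmor (act Phi (sd_snd x)) (fmor (act Phi (sd_snd y)) (sd_fst z))).
    by rewrite source_cmp.
  transitivity (cmp _ _ e6).
    apply: cmp_congr => //; exact: fcmp.
  transitivity (cmp _ _ e8); first exact: cmpA.
  apply: cmp_congr; first exact: cmp_congr.
  by rewrite act_cmpE.
Defined.

End SemidirectCategory.

Section SemidirectConcentration.
Variables (X Y : conc_category) (Phi : functor Y (aut_category X)).

Definition compatible : Prop := forall (a a' : mor X) (f f' : mor Y),
  conc_rel a a' -> conc_rel f f' ->
  conc_rel (fmor (act Phi f) a) (fmor (act Phi f') a').

Definition induced_by (phi : monoid_action (conc_monoid X) (conc_monoid Y)) :
    Prop :=
  forall (f : mor Y) (a : mor X), phi (cls f) (cls a) = cls (fmor (act Phi f) a).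

Definition sdprod_rel (x y : mor (sdprod_category Phi)) : Prop :=
  conc_rel (sd_fst x) (sd_fst y) /\ conc_rel (sd_snd x) (sd_snd y).

Hypothesis Phi_compat : compatible.
Variable phi : monoid_action (conc_monoid X) (conc_monoid Y).
Hypothesis phi_ind : induced_by phi.

(* The third clause ([conc_ex]) uses that each phi[f] is injective, which
   compatibility of Phi alone does not imply. *)
Lemma sdprod_rel_concentration : is_concentration sdprod_rel.
Proof.
have PX := conc_relP X; have PY := conc_relP Y.
split.
- by have [A] := conc_inh PX; have [B] := conc_inh PY; split; exact: (A, B).
- by move=> x; split; [exact: conc_refl PX _|exact: conc_refl PY _].
- by move=> x y [? ?]; split; [exact: conc_sym PX _ _ _|exact: conc_sym PY _ _ _].
- move=> x y z [a b] [c d].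
  by split; [exact: conc_trans PX _ _ _ a c|exact: conc_trans PY _ _ _ b d].
- by move=> A B; split; [exact: conc_id PX _ _|exact: conc_id PY _ _].
- move=> x x' y y' e e' [a b] [c d]; split => /=.
    by apply: (conc_cmp PX) => //; exact: Phi_compat.
  exact: (conc_cmp PY).
- move=> x y.
  have [f [g [ff gg fg]]] := conc_ex PY (sd_snd x) (sd_snd y).
  have [a [c [aa cc ac]]] := conc_ex PX (sd_fst x) (fmor (act Phi f) (sd_fst y)).
  have inv k : exists G : functor X X,
      functor_comp G (act Phi k) = functor_id X /\
      functor_comp (act Phi k) G = functor_id X.
    exact: autofunctor_inv (fmor Phi k : autofunctor X).
  have [F [_ FK]] := inv f; have [G [_ GK]] := inv g.
  have obK K k (A : ob X) : functor_comp (act Phi k) K = functor_id X ->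
      fob (act Phi k) (fob K A) = A by move=> /(congr1 (fun H => fob H A)).
  have morK K k (b : mor X) : functor_comp (act Phi k) K = functor_id X ->
      fmor (act Phi k) (fmor K b) = b by move=> /(congr1 (fun H => fmor H b)).
  pose b := fmor F c.
  have bb : conc_rel b (sd_fst y).
    apply/cls_eqP; apply: (bij_inj (maut_bij (phi (cls f)))).
    by rewrite !phi_ind /b (morK _ _ _ FK); apply/cls_eqP.
  have xe : source a = fob (act Phi f) (target b).
    by rewrite -ftarget /b (morK _ _ _ FK).
  have ye : source b = fob (act Phi g) (fob G (source b)).
    by rewrite (obK _ _ _ GK).
  exists (SdprodMor xe), (SdprodMor ye); split=> //=.
  by rewrite fg.
- move=> x x' y y' z z' m n xy yz xn mz.
  move=> [/cls_eqP a /cls_eqP b] [/cls_eqP c /cls_eqP d] [/cls_eqP k /cls_eqP l].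
  move=> [/cls_eqP /= mE /cls_eqP /= mE'] [/cls_eqP /= nE /cls_eqP /= nE'].
  move: mE mE' nE nE'; rewrite !cls_cmp -!phi_ind => mE mE' nE nE'.
  split; apply/cls_eqP; rewrite /= !cls_cmp -?phi_ind ?mE ?mE' ?nE ?nE'.
    by rewrite -a -b -c -d -k gmulfM /= (maut_morph (phi _)).2 !mulgA.
  by rewrite -b -d -l mulgA.
Qed.

Definition sdprod_conc_category : conc_category :=
  ConcCategory sdprod_rel_concentration.

End SemidirectConcentration.

(* Main.v *)
Require Import Defs.
From HB Require Import structures.
From mathcomp Require Import all_boot.
From mathcomp Require Import all_classical.

(** Call a map [u] from the morphisms of X to a monoid M an embedding of the
    concentration if it sends identities to 1 and compositions to products, and
    if its fibres are the classes of the concentration.  Such a map descends to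
    an injective monoid morphism from the concentration monoid of X to M:
    multiplicativity holds because any two classes have composable
    representatives ([cls_ex]), and injectivity because equal values force equal
    classes.  If moreover [u] is onto, the descended map is an isomorphism
    ([descend_iso]).

    The three parts are three embeddings.
    - Sub: a morphism h of the subcategory is sent to its class in the big
      concentration monoid; the descended map is the canonical inclusion.
    - Quotient: f is sent to the class of [f] modulo the submonoid.  The quotient
      concentration is the pull-back of the congruence of that submonoid
      ([quotient_relE]), so the fibres are as required.
    - Semidirect product: (alpha, f) is sent to ([alpha], [f]), and products
      agree because phi is induced by Phi.  The point with content is
      surjectivity: any alpha and f must be the components of an arrow, that is,
      the source of alpha must be in the image of the functor Phi_f on objects,
      which holds because Phi_f is invertible. *)

Set Implicit Arguments.
Unset Strict Implicit.
Unset Printing Implicit Defensive.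

Local Open Scope classical_set_scope.
Local Open Scope group_scope.

(** The descended map is defined on representatives; for [u] the class of an
    arrow of a subcategory it is, by unfolding, the canonical inclusion
    [subc_incl]. *)
Definition descend (X : conc_category) (M : Type) (u : mor X -> M)
    (x : conc_monoid X) : M :=
  u (repr (x : {eq_quot (@conc_relb X)}%qT)).

Record conc_embedding (X : conc_category) (M : monoidType) (u : mor X -> M) :
    Prop := ConcEmbedding {
  embedding_fibre : forall f g, conc_rel f g <-> u f = u g;
  embedding_id : forall A, u (idm A) = 1;
  embedding_cmp : forall f g (e : source f = target g),
    u (cmp f g e) = u f * u g
}.

Section ConcEmbedding.
Variables (X : conc_category) (M : monoidType) (u : mor X -> M).
Hypothesis uP : conc_embedding u.

Lemma descend_cls f : descend u (cls f) = u f.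
Proof.
apply: (embedding_fibre uP _ _).1; apply/cls_eqP.
by rewrite {1}/cls reprK.
Qed.

(** Any two classes have composable representatives, so multiplicativity on
    compositions is multiplicativity on all products. *)
Lemma descend_morphism : monoid_morphism (descend u).
Proof.
split=> [|x y].
  have [A] := conc_inh (conc_relP X).
  by rewrite (cls_id A) descend_cls (embedding_id uP).
have [f [g [-> -> e]]] := cls_ex x y.
by rewrite -(cls_cmp e) !descend_cls (embedding_cmp uP).
Qed.

Lemma descend_inj : injective (descend u).
Proof.
move=> x y; have [[f ->] [g ->]] := (clsP x, clsP y).
by rewrite !descend_cls => /(embedding_fibre uP) /cls_eqP.
Qed.

Lemma descend_iso : (forall m, exists f, u f = m) -> monoid_iso (conc_monoid X) M.
Proof.
move=> u_surj; exists (descend u); split; first exact: descend_morphism.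
have [s sK] := choice u_surj.
have csK : cancel (fun m => cls (s m)) (descend u).
  by move=> m; rewrite descend_cls sK.
exists (fun m => cls (s m)) => // x.
by apply: descend_inj; rewrite csK.
Qed.

End ConcEmbedding.

Lemma subc_embedding (X : conc_category) (B : sub_concentration X) :
  @conc_embedding (conc_category_of_sub B) (conc_monoid X)
    (fun h => cls (val h)).
Proof.
split=> [f g|A|f g e].
- by split=> [fg|/cls_eqP]; first exact/cls_eqP.
- by rewrite -cls_id.
- exact: cls_cmp.
Qed.

Lemma quotient_embedding (X : conc_category) (B : sub_concentration X)
    (nB : normal_sub_concentration B) :
  @conc_embedding (quotient_conc_category nB)
    (quotient_monoid (subc_normal_submonoid nB))
    (fun f => nsm_pi (subc_normal_submonoid nB) (@cls X f)).
Proof.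
split=> [f g|A|f g e].
- by split=> [/quotient_relE fg|/nsm_piP fg];
    [exact/nsm_piP|exact/quotient_relE].
- by rewrite -(@cls_id X).
- by rewrite (@cls_cmp X) -quotient_mulE.
Qed.

Section SemidirectEmbedding.
Variables (X Y : conc_category) (Phi : functor Y (aut_category X)).
Hypothesis Phi_compat : compatible Phi.
Variable phi : monoid_action (conc_monoid X) (conc_monoid Y).
Hypothesis phi_ind : induced_by Phi phi.

Lemma sdprod_embedding :
  @conc_embedding (sdprod_conc_category Phi_compat phi_ind) (sdprod_monoid phi)
    (fun x => (cls (sd_fst x), cls (sd_snd x))).
Proof.
split=> [x y|[A B]|x y e].
- by split=> [[/cls_eqP -> /cls_eqP ->]|[/cls_eqP ? /cls_eqP ?]].
- by rewrite /= -!cls_id.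
- by rewrite /= !cls_cmp -phi_ind.
Qed.

(** An arrow alpha pairs with f as soon as its source is Phi_f(C) for some object
    C; a strict inverse of Phi_f provides C. *)
Lemma sdprod_mor_ex (a : mor X) (f : mor Y) :
  exists x : sdprod_mor Phi, sd_fst x = a /\ sd_snd x = f.
Proof.
have [G [_ GK]] := autofunctor_inv (fmor Phi f : autofunctor X).
have aE : source a = fob (act Phi f) (fob G (source a)).
  by have := congr1 (fun H => fob H (source a)) GK.
by exists (SdprodMor aE).
Qed.

Lemma sdprod_embedding_surj (m : sdprod_monoid phi) :
  exists x : sdprod_mor Phi, (cls (sd_fst x), cls (sd_snd x)) = m.
Proof.
case: m => m n; have [[a ->] [f ->]] := (clsP m, clsP n).
by have [x [<- <-]] := sdprod_mor_ex a f; exists x.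
Qed.

End SemidirectEmbedding.

Theorem theorem1p7 :
  (forall (X : conc_category) (B : sub_concentration X),
     [/\ forall f : mor (conc_category_of_sub B), subc_incl (cls f) = cls (val f),
         monoid_morphism (@subc_incl X B),
         injective (@subc_incl X B)
       & submonoid (range (@subc_incl X B))]) /\
  (forall (X : conc_category) (B : sub_concentration X)
     (nB : normal_sub_concentration B),
     monoid_iso (conc_monoid (quotient_conc_category nB))
                (quotient_monoid (subc_normal_submonoid nB))) /\
  (forall (X Y : conc_category) (Phi : functor Y (aut_category X))
     (Phi_compat : compatible Phi)
     (phi : monoid_action (conc_monoid X) (conc_monoid Y))
     (phi_ind : induced_by Phi phi),
     monoid_iso (conc_monoid (sdprod_conc_category Phi_compat phi_ind))
                (sdprod_monoid phi)).
Proof.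
split=> [X B|]; last split=> [X B nB|X Y Phi Phi_compat phi phi_ind].
- split; [exact: subc_inclE| | |exact: subc_range_submonoid].
  + exact: descend_morphism (subc_embedding B).
  + exact: descend_inj (subc_embedding B).
- apply: descend_iso (quotient_embedding nB) _ => q.
  have [x ->] := nsm_pi_surj q; have [f ->] := clsP x.
  by exists f.
- apply: descend_iso (sdprod_embedding Phi_compat phi_ind) _ => m.
  exact: sdprod_embedding_surj m.
Qed.
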